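(* Let $A\in\mathbb{R}^{m\times n}$; let $Z\in\mathbb{R}^{m\times \ell}$ have orthonormal columns, so that $Z^TZ=I_\ell$; let $\hat Z\in\mathbb{R}^{m\times \ell}$ (a perturbation of $Z$), and set $$\epsilon_Z\equiv \|\hat Z^{\dagger}\|_2\,\|Z-\hat Z\|_2=\|\hat Z\|_2\,\|\hat Z^{\dagger}\|_2\,\frac{\|\hat Z-Z\|_2}{\|\hat Z\|_2}.$$ Let $\|\cdot\|_{(p)}$ be a Schatten $p$-norm. 1. If $\operatorname{rank}(\hat Z)=\operatorname{rank}(Z)$, then $$\|(I-ZZ^T)A\|_{(p)}-\epsilon_Z\|A\|_{(p)}\ \le\ \|(I-\hat Z\hat Z^{\dagger})A\|_{(p)}\ \le\ \|(I-ZZ^T)A\|_{(p)}+\epsilon_Z\|A\|_{(p)}.$$ 2. If $\|Z-\hat Z\|_2\le 1/2$, then $\operatorname{rank}(\hat Z)=\operatorname{rank}(Z)$ and $\epsilon_Z\le 2\,\|Z-\hat Z\|_2$.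
   Context: For a real matrix $M\in\mathbb{R}^{m\times n}$ with singular values $\sigma_1(M)\ge\dots\ge\sigma_r(M)\ge 0$, $r=\min\{m,n\}$, the Schatten $p$-norm is $\|M\|_{(p)}=\left(\sum_{j=1}^r\sigma_j(M)^p\right)^{1/p}$ for integers $p\ge1$, and $\|M\|_{(\infty)}=\|M\|_2=\sigma_1(M)$ (the two-norm) for $p=\infty$. $M^{\dagger}$ denotes the Moore-Penrose inverse. *)

(* Defs.v *)
From HB Require Import structures.
From mathcomp Require Import all_boot all_order all_algebra.
From mathcomp Require Import polyrcf.
From mathcomp Require Import boolp classical_sets reals exp.

Set Implicit Arguments.
Unset Strict Implicit.
Unset Printing Implicit Defensive.

Import Order.TTheory GRing.Theory Num.Theory.

Local Open Scope ring_scope.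

Section SchattenNorms.
Variables (R : realType) (m n : nat).
Implicit Type M : 'M[R]_(m, n).

(* [rootsR] lists each real root once; [nseq] restores the algebraic
   multiplicity [mup].  As M^T M is symmetric, all its eigenvalues are real. *)
Definition gram_eigenvalues M : seq R :=
  let q := char_poly (M^T *m M) in
  sort >=%R (flatten [seq nseq (mup x q) x | x <- rootsR q]).

(* Indices start at 0: [singular_value M j] is sigma_{j+1}(M) for
   j < min(m, n), and it is 0 for j >= min(m, n). *)
Definition singular_value M (j : nat) : R :=
  Num.sqrt (gram_eigenvalues M)`_j.

Definition two_norm M : R := singular_value M 0.

Inductive schatten_index : Type :=
  | SchattenFin (p : nat) of (1 <= p)%N
  | SchattenInf.

Definition schatten_norm (p : schatten_index) M : R :=
  match p with
  | SchattenFin q _ =>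
      (\sum_(j < minn m n) singular_value M j ^+ q) `^ (q%:R^-1)
  | SchattenInf => two_norm M
  end.

End SchattenNorms.

Section MoorePenrose.
Variables (R : realType) (m n : nat).
Implicit Types (M : 'M[R]_(m, n)) (X Y : 'M[R]_(n, m)).

Definition penrose M X : Prop :=
  [/\ M *m X *m M = M, X *m M *m X = X,
      (M *m X)^T = M *m X & (X *m M)^T = X *m M].

Definition pseudoinverse M : 'M[R]_(n, m) :=
  xget 0 [set X | penrose M X]%classic.

End MoorePenrose.

Lemma gram_unit (R : realType) (m n : nat) (M : 'M[R]_(m, n)) :
  row_free M -> M *m M^T \in unitmx.
Proof.
move=> fM; rewrite -row_free_unit; apply: inj_row_free => v vG0.
have : v *m M *m (v *m M)^T = 0.
  by rewrite trmx_mul mulmxA -(mulmxA v) vG0 mul0mx.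
set w := v *m M => /matrixP /(_ 0 0); rewrite !mxE => w0.
suff : w = 0 by move/eqP; rewrite (mulmx_free_eq0 _ fM) => /eqP.
apply/rowP => j; rewrite [RHS]mxE.
have s0 : \sum_j w 0 j ^+ 2 = 0.
  by rewrite -[RHS]w0; apply: eq_bigr => k _; rewrite [w^T _ _]mxE expr2.
have /(_ j isT) /eqP := psumr_eq0P (fun k _ => sqr_ge0 (w 0 k)) s0.
by rewrite sqrf_eq0 => /eqP.
Qed.

Lemma penrose_exists (R : realType) (m n : nat) (M : 'M[R]_(m, n)) :
  exists X, penrose M X.
Proof.
have [r [C [B [-> fC fB]]]] : exists r (C : 'M_(m, r)) (B : 'M_(r, n)),
    [/\ M = C *m B, row_free C^T & row_free B].
  exists (\rank M), (col_base M), (row_base M); rewrite mulmx_base row_base_free.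
  by split=> //; rewrite /row_free mxrank_tr; exact: col_base_full.
have uB : B *m B^T \in unitmx by exact: gram_unit.
have uC : C^T *m C \in unitmx by have := gram_unit fC; rewrite trmxK.
pose X := B^T *m invmx (B *m B^T) *m invmx (C^T *m C) *m C^T.
have MX : C *m B *m X = C *m invmx (C^T *m C) *m C^T.
  rewrite /X !mulmxA -(mulmxA C B B^T) -(mulmxA C (B *m B^T)).
  by rewrite mulmxV // mulmx1.
have XM : X *m (C *m B) = B^T *m invmx (B *m B^T) *m B.
  rewrite /X mulmxA -(mulmxA _ C^T C) -(mulmxA _ (invmx _) (C^T *m C)).
  by rewrite mulVmx // mulmx1.
exists X; split.
- rewrite MX mulmxA -(mulmxA _ C^T C) -(mulmxA C).
  by rewrite mulVmx // mulmx1.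
- rewrite XM {1}/X !mulmxA -(mulmxA _ B B^T) -(mulmxA B^T).
  by rewrite mulVmx // mulmx1.
- by rewrite MX !trmx_mul trmxK trmx_inv trmx_mul trmxK mulmxA.
- by rewrite XM !trmx_mul trmxK trmx_inv trmx_mul trmxK mulmxA.
Qed.

Lemma penrose_uniq (R : realType) (m n : nat) (M : 'M[R]_(m, n)) X Y :
  penrose M X -> penrose M Y -> X = Y.
Proof.
case=> X1 X2 X3 X4 [Y1 Y2 Y3 Y4].
have MXY : M *m X = M *m Y.
  rewrite -X3 -{1}Y1 -(mulmxA (M *m Y)) trmx_mul X3 Y3.
  by rewrite mulmxA X1.
have XMY : X *m M = Y *m M.
  rewrite -X4 -{1}Y1 -(mulmxA M) mulmxA trmx_mul Y4 X4.
  by rewrite -mulmxA (mulmxA M X M) X1.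
by rewrite -X2 XMY -mulmxA MXY mulmxA Y2.
Qed.

Lemma pseudoinverseP (R : realType) (m n : nat) (M : 'M[R]_(m, n)) :
  penrose M (pseudoinverse M).
Proof. exact: (@xgetPex _ 0 [set X | penrose M X]%classic (penrose_exists M)). Qed.

(* Main.v *)
Require Import Defs.
From HB Require Import structures.
From mathcomp Require Import all_boot all_order all_algebra.
From mathcomp Require Import reals.
From mathcomp Require Import polyrcf complex spectral exp ring lra.

Set Implicit Arguments.
Unset Strict Implicit.
Unset Printing Implicit Defensive.

Import Order.TTheory GRing.Theory Num.Theory.

Local Open Scope ring_scope.

(** Write P = Z Z^T and Q = Zhat Zhat^+; both are orthogonal projectors, and
    (I - Q) A = (I - P) A + (P - Q) A.  The two-sided estimate is thus the
    triangle inequality for the Schatten norm, once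
    ||(P - Q) A||_p <= ||P - Q||_2 ||A||_p and ||P - Q||_2 <= eps are known.

    For the second bound, P and Q have the same rank, and for such projectors
    ||P - Q||_2 <= ||(I - P) Q||_2 ([mx_bound_orthoproj_sub]).  Since
    (I - P) Z = 0, one has (I - P) Q = (I - P) (Zhat - Z) Zhat^+, whose
    two-norm is at most eps.

    The Schatten norm is handled through a variational formula: it is the
    maximum, over contractions F and G, of the l^p norm of the diagonal of
    F^T A G.  The maximum is attained by a singular value decomposition
    ([schatten_norm_diag_eq]).  That it is an upper bound
    ([schatten_norm_diag_le]) comes from writing each diagonal entry as a
    doubly substochastic average of singular values and using the convexity of
    t^p.  Minkowski's inequality on the diagonals then gives the triangle
    inequality, and moving B from A to F gives ||B A||_p <= ||B||_2 ||A||_p.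

    The singular value decomposition rests on the real spectral theorem
    ([symmetric_spectral]), which also identifies the roots of the
    characteristic polynomial of A^T A with the squared singular values.

    If ||Z - Zhat||_2 <= 1/2, then |x| = |Z x| <= |Zhat x| + |x| / 2, so
    |x| <= 2 |Zhat x|.  Hence Zhat is injective, and applying this to
    x = Zhat^+ y gives ||Zhat^+||_2 <= 2. *)

(** * Frobenius inner product and operator bounds *)

Section FrobeniusForm.
Variable R : realType.

Definition mxdot m n (X Y : 'M[R]_(m, n)) : R := \tr (X^T *m Y).

Definition sqnorm m n (X : 'M[R]_(m, n)) : R := mxdot X X.

Lemma mxdotE m n (X Y : 'M[R]_(m, n)) :
  mxdot X Y = \sum_i \sum_j X i j * Y i j.
Proof.
rewrite exchange_big; apply: eq_bigr => j _; rewrite mxE.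
by apply: eq_bigr => i _; rewrite mxE.
Qed.

Lemma mxdotC m n (X Y : 'M[R]_(m, n)) : mxdot X Y = mxdot Y X.
Proof. by rewrite /mxdot -mxtrace_tr trmx_mul trmxK. Qed.

Lemma mxdotDr m n (X Y Z : 'M[R]_(m, n)) :
  mxdot X (Y + Z) = mxdot X Y + mxdot X Z.
Proof. by rewrite /mxdot mulmxDr linearD. Qed.

Lemma mxdotZr m n a (X Y : 'M[R]_(m, n)) : mxdot X (a *: Y) = a * mxdot X Y.
Proof. by rewrite /mxdot -scalemxAr linearZ. Qed.

Lemma mxdot_mull m n k (A : 'M[R]_(m, n)) (X : 'M_(n, k)) Y :
  mxdot (A *m X) Y = mxdot X (A^T *m Y).
Proof. by rewrite /mxdot trmx_mul mulmxA. Qed.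

Lemma sqnormE m n (X : 'M[R]_(m, n)) : sqnorm X = \sum_i \sum_j X i j ^+ 2.
Proof.
by rewrite /sqnorm mxdotE; do 2!apply: eq_bigr => ? _; rewrite expr2.
Qed.

Lemma sqnorm_ge0 m n (X : 'M[R]_(m, n)) : 0 <= sqnorm X.
Proof.
by rewrite sqnormE; do 2!apply: sumr_ge0 => ? _; apply: sqr_ge0.
Qed.

Lemma sqnorm_eq0 m n (X : 'M[R]_(m, n)) : (sqnorm X == 0) = (X == 0).
Proof.
apply/eqP/eqP => [|->]; last by rewrite /sqnorm /mxdot mulmx0 mxtrace0.
rewrite sqnormE => X0; apply/matrixP => i j; rewrite mxE; apply/eqP.
have rows0 k : xpredT k -> 0 <= \sum_j X k j ^+ 2.
  by move=> _; apply: sumr_ge0 => ? _; apply: sqr_ge0.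
have /(_ i isT) row0 := psumr_eq0P rows0 X0.
have /(_ j isT)/eqP := psumr_eq0P (fun k _ => sqr_ge0 (X i k)) row0.
by rewrite sqrf_eq0.
Qed.

Lemma sqnorm0 m n : sqnorm (0 : 'M[R]_(m, n)) = 0.
Proof. by apply/eqP; rewrite sqnorm_eq0. Qed.

Lemma sqnormD m n (X Y : 'M[R]_(m, n)) :
  sqnorm (X + Y) = sqnorm X + 2 * mxdot X Y + sqnorm Y.
Proof.
rewrite /sqnorm mxdotDr !(mxdotC (X + Y)) !mxdotDr (mxdotC Y X); ring.
Qed.

Lemma sqnormZ m n a (X : 'M[R]_(m, n)) : sqnorm (a *: X) = a ^+ 2 * sqnorm X.
Proof. by rewrite /sqnorm mxdotZr mxdotC mxdotZr expr2 mulrA. Qed.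

Lemma sqnormN m n (X : 'M[R]_(m, n)) : sqnorm (- X) = sqnorm X.
Proof. by rewrite -scaleN1r sqnormZ sqrrN expr1n mul1r. Qed.

Lemma sqnormDZ m n a (X Y : 'M[R]_(m, n)) :
  sqnorm (X + a *: Y) = sqnorm X + 2 * a * mxdot X Y + a ^+ 2 * sqnorm Y.
Proof. by rewrite sqnormD mxdotZr sqnormZ; ring. Qed.

Lemma sqnorm_delta m n i j : sqnorm (delta_mx i j : 'M[R]_(m, n)) = 1.
Proof.
rewrite /sqnorm /mxdot trmx_delta mul_delta_mx /mxtrace (bigD1 j) //=.
rewrite mxE eqxx big1 ?addr0 // => k kj.
by rewrite mxE (negbTE kj).
Qed.

Lemma sqr_entry_le m n (X : 'M[R]_(m, n)) i j : X i j ^+ 2 <= sqnorm X.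
Proof.
rewrite sqnormE (bigD1 i) //= (bigD1 j) //= -addrA lerDl addr_ge0 //.
  by apply: sumr_ge0 => ? _; apply: sqr_ge0.
by apply: sumr_ge0 => ? _; apply: sumr_ge0 => ? _; apply: sqr_ge0.
Qed.

End FrobeniusForm.

Section OperatorBounds.
Variable R : realType.

(** The two-norm of M is at most |c|, expressed without singular values.
    For X with several columns this is the vector inequality summed over the
    columns; allowing them lets X stand for any product of matrices. *)
Definition mx_bound m n (c : R) (M : 'M[R]_(m, n)) : Prop :=
  forall k (X : 'M_(n, k)), sqnorm (M *m X) <= c ^+ 2 * sqnorm X.

Lemma mx_boundM m n k c d (M : 'M[R]_(m, n)) (N : 'M_(n, k)) :
  mx_bound c M -> mx_bound d N -> mx_bound (c * d) (M *m N).
Proof.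
move=> bM bN h X; rewrite -mulmxA (le_trans (bM _ _)) //.
rewrite exprMn -(mulrA (c ^+ 2)).
by rewrite ler_wpM2l ?sqr_ge0.
Qed.

Lemma mx_boundN m n c (M : 'M[R]_(m, n)) : mx_bound c M -> mx_bound c (- M).
Proof. by move=> bM k X; rewrite mulNmx sqnormN. Qed.

Lemma mx_boundZ m n a c (M : 'M[R]_(m, n)) :
  mx_bound c M -> mx_bound (a * c) (a *: M).
Proof.
by move=> bM k X; rewrite -scalemxAl sqnormZ exprMn
  -(mulrA (a ^+ 2)) ler_wpM2l ?sqr_ge0.
Qed.

Lemma mx_bound_le m n c d (M : 'M[R]_(m, n)) :
  0 <= c -> c <= d -> mx_bound c M -> mx_bound d M.
Proof.
move=> c0 cd bM k X; rewrite (le_trans (bM _ _)) // ler_wpM2r ?sqnorm_ge0 //.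
by rewrite lerXn2r // nnegrE (le_trans c0).
Qed.

Lemma mx_bound0 m n (M : 'M[R]_(m, n)) : mx_bound 0 M -> M = 0.
Proof.
move=> /(_ _ 1%:M); rewrite mulmx1 expr0n mul0r => le0.
by apply/eqP; rewrite -sqnorm_eq0 eq_le le0 sqnorm_ge0.
Qed.

(** Expanding 0 <= |M M^T X - c^2 X|^2 and bounding |M M^T X|^2 by
    c^2 |M^T X|^2 leaves c^2 |M^T X|^2 <= c^4 |X|^2, which settles the case of
    nonzero c; a zero bound means M = 0. *)
Lemma mx_bound_tr m n c (M : 'M[R]_(m, n)) : mx_bound c M -> mx_bound c M^T.
Proof.
move=> bM k X; have [c0|c0] := eqVneq c 0.
  rewrite c0 in bM *; rewrite (mx_bound0 bM) trmx0 mul0mx.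
  by rewrite sqnorm0 expr0n mul0r.
have := sqnorm_ge0 (M *m (M^T *m X) + (- c ^+ 2) *: X).
rewrite sqnormDZ mxdot_mull -/(sqnorm _) sqrrN => ge0.
have c2 : 0 < c ^+ 2 by rewrite exprn_even_gt0.
rewrite -(ler_pM2l c2); have := bM _ (M^T *m X).
move: ge0; set a := sqnorm (M^T *m X); set b := sqnorm (M *m _).
rewrite expr2 => ge0 le1; nra.
Qed.

Lemma mx_bound_entry m n c (M : 'M[R]_(m, n)) i j :
  0 <= c -> mx_bound c M -> `|M i j| <= c.
Proof.
move=> c0 /(_ _ (delta_mx j (0 : 'I_1))); rewrite sqnorm_delta mulr1.
move=> /(le_trans (sqr_entry_le _ i 0)); rewrite -colE mxE => le_c.
by rewrite -ler_sqr ?nnegrE // real_normK ?num_real.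
Qed.

Lemma mx_bound_col m n (M : 'M[R]_(m, n)) j :
  mx_bound 1 M -> \sum_i M i j ^+ 2 <= 1.
Proof.
move=> /(_ _ (delta_mx j (0 : 'I_1))).
rewrite sqnorm_delta -colE sqnormE expr1n mulr1; apply: le_trans.
by apply: ler_sum => i _; rewrite big_ord1 mxE.
Qed.

Lemma mx_bound_row m n (M : 'M[R]_(m, n)) i :
  mx_bound 1 M -> \sum_j M i j ^+ 2 <= 1.
Proof.
move=> /mx_bound_tr/(mx_bound_col i); apply: le_trans.
by apply: ler_sum => j _; rewrite mxE.
Qed.

(** |M X|^2 is the quadratic form of M^T M at X, hence a combination of
    squared entries of X with the coefficients d. *)
Lemma mx_bound_gram_diag m n c (M : 'M[R]_(m, n)) (d : 'rV_n) :
  M^T *m M = diag_mx d -> (forall i, d 0 i <= c ^+ 2) -> mx_bound c M.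
Proof.
move=> MM dle k X; rewrite /sqnorm mxdot_mull mulmxA MM !mxdotE mulr_sumr.
apply: ler_sum => i _; rewrite mulr_sumr; apply: ler_sum => j _.
rewrite mul_diag_mx mxE mulrCA -expr2.
by rewrite ler_wpM2r ?sqr_ge0.
Qed.

Lemma mx_bound_isometry m n (M : 'M[R]_(m, n)) :
  M^T *m M = 1%:M -> mx_bound 1 M.
Proof.
move=> MM k X; rewrite /sqnorm mxdot_mull mulmxA MM mul1mx expr1n mul1r.
exact: lexx.
Qed.

End OperatorBounds.

(** * Spectral theorem for real symmetric matrices *)

Section RealSpectral.
Variable R : realType.

(** An eigenvector x + i y over the complex field, with eigenvalue a + i b,
    exists by algebraic closedness.  Symmetry, (S x) . y = x . (S y), forces
    b (|x|^2 + |y|^2) = 0; then x and y are real eigenvectors, and one of them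
    is nonzero. *)
Lemma symmetric_eigenvector n (S : 'M[R]_n.+1) : S^T = S ->
  exists (a : R) (v : 'cV_n.+1), sqnorm v = 1 /\ S *m v = a *: v.
Proof.
move=> Ssym; have [z /eigenvalueP[u uS u0]] :=
  eigenvalue_closed (map_mx (real_complex R) S) (ltn0Sn n).
pose x := (map_mx (@complex.Re R) u)^T; pose y := (map_mx (@complex.Im R) u)^T.
case: z uS => a b uS.
have ReD : {morph (@complex.Re R) : z1 z2 / z1 + z2} by case=> ? ? [].
have ImD : {morph (@complex.Im R) : z1 z2 / z1 + z2} by case=> ? ? [].
have Sx : S *m x = a *: x + (- b) *: y.
  apply/colP => i; have /rowP/(_ i)/(congr1 (@complex.Re R)) := uS.
  rewrite !mxE (big_morph _ ReD (erefl : complex.Re 0 = 0)) => E.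
  transitivity (complex.Re ((a +i* b)%C * u 0 i)); last first.
    by case: (u 0 i) => ? ? /=; rewrite mulNr.
  rewrite -E; apply: eq_bigr => j _; rewrite -{1}Ssym !mxE mulrC.
  by case: (u 0 j) => ? ? /=; rewrite mulr0 subr0.
have Sy : S *m y = b *: x + a *: y.
  apply/colP => i; have /rowP/(_ i)/(congr1 (@complex.Im R)) := uS.
  rewrite !mxE (big_morph _ ImD (erefl : complex.Im 0 = 0)) => E.
  transitivity (complex.Im ((a +i* b)%C * u 0 i)); last first.
    by case: (u 0 i) => ? ? /=; rewrite addrC.
  rewrite -E; apply: eq_bigr => j _; rewrite -{1}Ssym !mxE mulrC.
  by case: (u 0 j) => ? ? /=; rewrite mulr0 add0r.
have xy0 : 0 < sqnorm x + sqnorm y.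
  rewrite lt_def addr_ge0 ?sqnorm_ge0 // andbT paddr_eq0 ?sqnorm_ge0 //.
  rewrite !sqnorm_eq0; apply: contra u0 => /andP[/eqP x0 /eqP y0].
  apply/eqP/rowP => i; have /colP/(_ i) := x0; have /colP/(_ i) := y0.
  by rewrite !mxE; case: (u 0 i) => ? ? /= -> ->.
have b0 : b = 0.
  have : mxdot (S *m x) y = mxdot x (S *m y) by rewrite mxdot_mull Ssym.
  rewrite Sx Sy (mxdotC (_ + _)) !mxdotDr !mxdotZr (mxdotC y x) => E.
  have : b * (sqnorm x + sqnorm y) = 0.
    rewrite mulrDr -(subrr (a * mxdot x y)).
    by rewrite -{1}(addrK (- b * sqnorm y) (a * _)) E mulNr; ring.
  by move=> /eqP; rewrite mulf_eq0 (gt_eqF xy0) orbF => /eqP.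
have [v v0 Sv] : exists2 v : 'cV_n.+1, v != 0 & S *m v = a *: v.
  have [x0|x0] := eqVneq x 0; last first.
    by exists x => //; rewrite Sx b0 oppr0 scale0r addr0.
  exists y; last by rewrite Sy b0 scale0r add0r.
  by apply: contraTneq xy0 => ->; rewrite x0 !sqnorm0 addr0 ltxx.
have nv : 0 < sqnorm v by rewrite lt_def sqnorm_eq0 v0 sqnorm_ge0.
exists a, ((Num.sqrt (sqnorm v))^-1 *: v); split.
  by rewrite sqnormZ exprVn sqr_sqrtr ?sqnorm_ge0 // mulVf ?gt_eqF.
by rewrite -scalemxAr Sv !scalerA mulrC.
Qed.

Lemma mx11_sqnorm n (v : 'cV[R]_n) : v^T *m v = (sqnorm v)%:M.
Proof. by rewrite [LHS]mx11_scalar /sqnorm /mxdot /mxtrace big_ord1. Qed.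

Lemma mx11_mxdot n (v w : 'cV[R]_n) : v^T *m w = (mxdot v w)%:M.
Proof. by rewrite [LHS]mx11_scalar /mxdot /mxtrace big_ord1. Qed.

(** The reflection through the hyperplane orthogonal to v - e exchanges e and
    v; when v = e the identity serves. *)
Lemma householder n (v e : 'cV[R]_n) : sqnorm v = 1 -> sqnorm e = 1 ->
  exists H : 'M_n, [/\ H^T = H, H *m H = 1%:M & H *m e = v].
Proof.
move=> nv ne; have [->|ve] := eqVneq v e.
  by exists 1%:M; rewrite trmx1 !mul1mx.
pose w := v - e; pose g := sqnorm w.
have g0 : g != 0 by rewrite /g sqnorm_eq0 subr_eq0.
have gE : mxdot w e = - g / 2.
  rewrite /g /w -scaleN1r sqnormDZ nv ne mxdotC mxdotDr mxdotZr -/(sqnorm e) ne.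
  by rewrite mxdotC; field.
pose H : 'M_n := 1%:M - (2 / g) *: (w *m w^T).
exists H; split.
- by rewrite /H linearB linearZ /= trmx1 trmx_mul trmxK.
- have ww : w *m w^T *m (w *m w^T) = g *: (w *m w^T).
    by rewrite -mulmxA (mulmxA w^T) mx11_sqnorm mul_scalar_mx -scalemxAr.
  rewrite /H mulmxBl mul1mx mulmxBr mulmx1 -scalemxAl -scalemxAr ww !scalerA.
  have -> : 2 / g * (2 / g) * g = 2 / g + 2 / g by field.
  by rewrite scalerDl opprB addrK subrK.
- rewrite /H mulmxBl mul1mx -scalemxAl -mulmxA mx11_mxdot gE mul_mx_scalar.
  rewrite scalerA; have -> : 2 / g * (- g / 2) = -1 by field.
  by rewrite scaleN1r opprK addrC subrK.
Qed.

Lemma isometry_block m n (V : 'M[R]_n) (W := block_mx (1%:M : 'M_m) 0 0 V) :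
  V^T *m V = 1%:M -> W^T *m W = 1%:M.
Proof.
move=> VV; rewrite /W tr_block_mx mulmx_block !trmx0 trmx1 !mulmx0 !mul0mx VV.
by rewrite !add0r !addr0 mulmx1 -scalar_mx_block.
Qed.

Lemma diag_block_conj m n (a : 'rV[R]_m) (d : 'rV_n) (V : 'M_n)
    (W := block_mx (1%:M : 'M_m) 0 0 V) :
  W *m diag_mx (row_mx a d) *m W^T =
  block_mx (diag_mx a) 0 0 (V *m diag_mx d *m V^T).
Proof.
rewrite /W tr_block_mx diag_mx_row !mulmx_block !trmx0 trmx1.
by rewrite !(mulmx0, mul0mx, mul1mx, mulmx1, add0r, addr0).
Qed.

(** Deflation: conjugating S by a reflection that sends the first basis vector
    to an eigenvector makes its first column, hence also its first row, zero
    off the diagonal. *)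
Theorem symmetric_spectral n (S : 'M[R]_n) : S^T = S ->
  exists (V : 'M_n) (d : 'rV_n),
    [/\ V^T *m V = 1%:M & S = V *m diag_mx d *m V^T].
Proof.
elim: n S => [|n IHn] S Ssym.
  by exists 0, 0; split; apply/matrixP => -[].
have [a [v [nv Sv]]] := symmetric_eigenvector Ssym.
pose e : 'cV[R]_n.+1 := delta_mx 0 0.
have [H [Hsym HH He]] := householder nv (sqnorm_delta R 0 0 : sqnorm e = 1).
pose T := H *m S *m H.
have Tsym : T^T = T by rewrite /T !trmx_mul Hsym Ssym mulmxA.
have Te : T *m e = a *: e.
  by rewrite /T -mulmxA He -mulmxA Sv -scalemxAr -He mulmxA HH mul1mx.
have ST : S = H *m (T *m H) by rewrite /T -!mulmxA HH mulmx1 mulmxA HH mul1mx.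
move: T Tsym Te ST => T Tsym Te ST.
have Tcol i : T i 0 = a * (i == 0)%:R.
  by have /colP/(_ i) := Te; rewrite -colE !mxE eqxx andbT.
have TE : T = block_mx (a%:M : 'M_1) 0 0 (drsubmx (T : 'M_(1 + n))).
  have l0 : lshift n (0 : 'I_1) = 0 by exact: val_inj.
  rewrite -[LHS](@submxK _ 1 n 1 n).
  have -> : @ulsubmx _ 1 n 1 n T = a%:M.
    by apply/matrixP => i j; rewrite !ord1 !mxE l0 Tcol eqxx mulr1.
  have -> : @ursubmx _ 1 n 1 n T = 0.
    by apply/matrixP => i j; rewrite !ord1 -[T]Tsym !mxE l0 Tcol mulr0.
  have -> // : @dlsubmx _ 1 n 1 n T = 0.
  by apply/matrixP => i j; rewrite !ord1 !mxE l0 Tcol mulr0.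
have [V [d [VV TV]]] : exists (V : 'M_n) (d : 'rV_n),
    [/\ V^T *m V = 1%:M & drsubmx (T : 'M_(1 + n)) = V *m diag_mx d *m V^T].
  by apply: IHn; rewrite trmx_drsub Tsym.
pose W : 'M_n.+1 := block_mx (1%:M : 'M_1) 0 0 V.
pose f : 'rV_n.+1 := row_mx (a%:M : 'rV_1) d.
have WW : W^T *m W = 1%:M by exact (@isometry_block 1 n V VV).
have TW : T = W *m diag_mx f *m W^T.
  rewrite TE TV; have -> : a%:M = diag_mx (a%:M : 'rV_1) :> 'M_1.
    by apply/matrixP => i j; rewrite !ord1 !mxE.
  by exact (esym (@diag_block_conj 1 n a%:M d V)).
exists (H *m W), f; rewrite trmx_mul Hsym; split.
  by rewrite -mulmxA (mulmxA H) HH mul1mx.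
by rewrite ST TW !mulmxA.
Qed.

End RealSpectral.

(** * Convexity of powers and finite l^p norms *)

Section PowerConvexity.
Variable R : realType.

Lemma expr_above_tangent k (s t : R) : 0 <= s -> 0 <= t ->
  t ^+ k.+1 + k.+1%:R * t ^+ k * (s - t) <= s ^+ k.+1.
Proof.
move=> s0 t0; elim: k => [|k IHk]; first by rewrite expr0 !expr1 !mul1r subrKC.
apply: (@le_trans _ _ (s * (t ^+ k.+1 + k.+1%:R * t ^+ k * (s - t)))).
  rewrite -subr_ge0.
  rewrite (_ : _ - _ = k.+1%:R * t ^+ k * (s - t) ^+ 2); last first.
    by rewrite -(natr1 k.+1) !exprS; ring.
  by rewrite mulr_ge0 ?sqr_ge0 // mulr_ge0 ?exprn_ge0.
by rewrite (exprS s) ler_wpM2l.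
Qed.

(** Sum the tangent inequality at the weighted mean t of the s i.  When the
    weights w do not add up to 1 there remains an extra term
    k t^(k+1) (1 - sum w), which is nonnegative. *)
Lemma jensen_expr k n (w s : 'I_n -> R) :
    (forall i, 0 <= w i) -> (forall i, 0 <= s i) -> \sum_i w i <= 1 ->
  (\sum_i w i * s i) ^+ k.+1 <= \sum_i w i * s i ^+ k.+1.
Proof.
move=> w0 s0 w1; move tE: (\sum_i w i * s i) => t.
have t0 : 0 <= t by rewrite -tE; apply: sumr_ge0 => i _; rewrite mulr_ge0.
apply: (@le_trans _ _
  (\sum_i w i * (t ^+ k.+1 + k.+1%:R * t ^+ k * (s i - t)))); last first.
  by apply: ler_sum => i _; rewrite ler_wpM2l ?expr_above_tangent.
have -> : \sum_i w i * (t ^+ k.+1 + k.+1%:R * t ^+ k * (s i - t)) =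
    t ^+ k.+1 + k%:R * t ^+ k.+1 * (1 - \sum_i w i).
  transitivity ((t ^+ k.+1 - k.+1%:R * t ^+ k * t) * (\sum_i w i)
                + k.+1%:R * t ^+ k * (\sum_i w i * s i)).
    rewrite !mulr_sumr -big_split /=.
    by apply: eq_bigr => i _; rewrite exprS; ring.
  by rewrite tE -(natr1 k) exprS; ring.
by rewrite lerDl mulr_ge0 ?subr_ge0 // mulr_ge0 ?exprn_ge0.
Qed.

End PowerConvexity.

Section LpNorm.
Variable R : realType.

(** Indexed like the Schatten norms, so that the finite and the infinite
    exponents can be treated by the same statements. *)
Definition lp_norm (p : schatten_index) n (x : 'I_n -> R) : R :=
  match p with
  | SchattenFin q _ => (\sum_i `|x i| ^+ q) `^ q%:R^-1
  | SchattenInf => \big[Num.max/0]_i `|x i|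
  end.

Lemma root_expr q (c : R) : (0 < q)%N -> 0 <= c -> (c ^+ q) `^ q%:R^-1 = c.
Proof.
move=> q0 c0; rewrite -powR_mulrn // -powRrM mulfV ?powRr1 //.
by rewrite pnatr_eq0 -lt0n.
Qed.

Lemma expr_root q (c : R) : (0 < q)%N -> 0 <= c -> (c `^ q%:R^-1) ^+ q = c.
Proof.
move=> q0 c0; rewrite -powR_mulrn ?powR_ge0 // -powRrM mulVf ?powRr1 //.
by rewrite pnatr_eq0 -lt0n.
Qed.

Lemma lp_norm_ge0 p n (x : 'I_n -> R) : 0 <= lp_norm p x.
Proof.
case: p => [q q1|] /=; first exact: powR_ge0.
by elim/big_ind: _ => // a b a0 b0; rewrite le_max a0.
Qed.

Lemma lp_norm_finE q (q1 : (1 <= q)%N) n (x : 'I_n -> R) :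
  lp_norm (SchattenFin q1) x ^+ q = \sum_i `|x i| ^+ q.
Proof. by rewrite expr_root // sumr_ge0 // => i _; rewrite exprn_ge0. Qed.

Lemma lp_norm_fin_le q (q1 : (1 <= q)%N) n (x : 'I_n -> R) c : 0 <= c ->
  (lp_norm (SchattenFin q1) x <= c) = (\sum_i `|x i| ^+ q <= c ^+ q).
Proof.
by move=> c0; rewrite -(lp_norm_finE q1) ler_pXn2r // nnegrE ?lp_norm_ge0.
Qed.

Lemma lp_norm_inf_le n (x : 'I_n -> R) c : 0 <= c ->
  reflect (forall i, `|x i| <= c) (lp_norm SchattenInf x <= c).
Proof.
move=> c0; apply: (iffP idP) => [le i|le].
  by apply: le_trans le; rewrite /= (bigD1 i) //= le_max lexx.
by rewrite /=; elim/big_ind: _ => // a b ac bc; rewrite ge_max ac.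
Qed.

Lemma ler_lp_norm_inf n (x : 'I_n -> R) i : `|x i| <= lp_norm SchattenInf x.
Proof.
have /lp_norm_inf_le := lexx (lp_norm SchattenInf x).
by apply; apply: lp_norm_ge0.
Qed.

Lemma lp_norm_eq p n (x y : 'I_n -> R) :
  (forall i, `|x i| = `|y i|) -> lp_norm p x = lp_norm p y.
Proof.
by move=> xy; case: p => [q q1|] /=; [congr (_ `^ _)|];
   apply: eq_bigr => i _; rewrite xy.
Qed.

(** Row sums at most 1 allow Jensen's inequality in each row; column sums at
    most 1 allow the result to be summed over the rows. *)
Lemma lp_norm_substochastic p k n (W : 'I_k -> 'I_n -> R) (x : 'I_k -> R) s :
    (forall i j, 0 <= W i j) ->
    (forall i, \sum_j W i j <= 1) -> (forall j, \sum_i W i j <= 1) ->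
    (forall i, `|x i| <= \sum_j W i j * `|s j|) ->
  lp_norm p x <= lp_norm p s.
Proof.
move=> W0 Wrow Wcol xW; case: p => [q q1|].
  rewrite lp_norm_fin_le ?lp_norm_ge0 // lp_norm_finE.
  case: q q1 => // q _.
  apply: (@le_trans _ _ (\sum_i \sum_j W i j * `|s j| ^+ q.+1)).
    apply: ler_sum => i _; apply: le_trans (jensen_expr q _ _ _) => //.
    by rewrite lerXn2r // nnegrE // sumr_ge0 // => j _; rewrite mulr_ge0.
  rewrite exchange_big /=; apply: ler_sum => j _.
  by rewrite -mulr_suml ler_piMl ?exprn_ge0.
apply/lp_norm_inf_le => [|i]; first exact: lp_norm_ge0.
rewrite (le_trans (xW i)) //.
apply: (@le_trans _ _ (\sum_j W i j * lp_norm SchattenInf s)).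
  apply: ler_sum => j _; rewrite ler_wpM2l //.
  exact: ler_lp_norm_inf.
by rewrite -mulr_suml ler_piMl ?lp_norm_ge0.
Qed.

Lemma lp_normZ p n a (x : 'I_n -> R) :
  lp_norm p (fun i => a * x i) = `|a| * lp_norm p x.
Proof.
case: p => [q q1|] /=.
  under eq_bigr do rewrite normrM exprMn.
  by rewrite -mulr_sumr powRM ?root_expr ?exprn_ge0 ?sumr_ge0 //
     => i _; rewrite exprn_ge0.
rewrite (big_morph _ (_ : {morph *%R `|a| : u v / Num.max u v}) (mulr0 _)).
  by apply: eq_bigr => i _; rewrite normrM.
by move=> u v; rewrite maxr_pMr.
Qed.

(** Minkowski's inequality.  With a and b the norms of x and y, the number
    (|x i| + |y i|) / (a + b) is the average of |x i| / a and |y i| / b with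
    weights a / (a + b) and b / (a + b), to which Jensen's inequality
    applies. *)
Lemma lp_norm_triangle p n (x y : 'I_n -> R) :
  lp_norm p (fun i => x i + y i) <= lp_norm p x + lp_norm p y.
Proof.
case: p => [q q1|]; last first.
  apply/lp_norm_inf_le => [|i]; first by rewrite addr_ge0 ?lp_norm_ge0.
  by rewrite (le_trans (ler_normD _ _)) // lerD ?ler_lp_norm_inf.
move aE: (lp_norm _ x) => a; move bE: (lp_norm _ y) => b.
have [a0 b0] : 0 <= a /\ 0 <= b by rewrite -aE -bE !lp_norm_ge0.
have fin0 z : lp_norm (SchattenFin q1) z = 0 -> forall i : 'I_n, z i = 0.
  move=> z0 i; have := lp_norm_finE q1 z; rewrite z0 expr0n gtn_eqF // => /esym.
  move=> /psumr_eq0P/(_ i isT)/eqP; rewrite expf_eq0 q1 normr_eq0 => H.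
  by apply/eqP/H => j _; rewrite exprn_ge0.
have [a00|ane] := eqVneq a 0.
  rewrite a00 add0r -bE (@lp_norm_eq _ _ _ y) ?lexx // => i.
  by rewrite (fin0 x (etrans aE a00)) add0r.
have [b00|bne] := eqVneq b 0.
  rewrite b00 addr0 -aE (@lp_norm_eq _ _ _ x) ?lexx // => i.
  by rewrite (fin0 y (etrans bE b00)) addr0.
have agt : 0 < a by rewrite lt_def ane.
have bgt : 0 < b by rewrite lt_def bne.
have abgt : 0 < a + b by rewrite addr_gt0.
rewrite lp_norm_fin_le ?addr_ge0 //; case: q q1 aE bE {fin0} => // q q1 aE bE.
apply: (@le_trans _ _ (\sum_i (a + b) ^+ q.+1 *
   (a / (a + b) * (`|x i| / a) ^+ q.+1 + b / (a + b) * (`|y i| / b) ^+ q.+1))).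
  apply: ler_sum => i _.
  have := @jensen_expr _ q 2
    (fun j => if val j == 0 then a / (a + b) else b / (a + b))
    (fun j => if val j == 0 then `|x i| / a else `|y i| / b).
  rewrite !big_ord_recl !big_ord0 /= !addr0 => J.
  rewrite (le_trans _ (ler_wpM2l _ (J _ _ _))) ?exprn_ge0 ?(ltW abgt) //;
    first last.
  - by rewrite -mulrDl divff ?gt_eqF.
  - by move=> j; case: ifP => _; rewrite divr_ge0 // ltW.
  - by move=> j; case: ifP => _; rewrite divr_ge0 // ltW.
  rewrite -exprMn (_ : (a + b) * _ = `|x i| + `|y i|); last first.
    by field; rewrite ane bne gt_eqF.
  by rewrite lerXn2r ?nnegrE ?addr_ge0 // ler_normD.
rewrite -mulr_sumr big_split /= -!mulr_sumr.
have sumE z c : c != 0 -> lp_norm (SchattenFin q1) z = c ->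
    \sum_(i < n) (`|z i| / c) ^+ q.+1 = 1.
  move=> c0 cE; under eq_bigr do rewrite expr_div_n.
  by rewrite -mulr_suml -(lp_norm_finE q1) cE divff // expf_neq0.
by rewrite !sumE // !mulr1 -mulrDl divff ?gt_eqF // mulr1.
Qed.

End LpNorm.

(** * Singular value decomposition *)

Section SingularValues.
Variable R : realType.

Lemma char_poly_orthogonal_conj n (V D : 'M[R]_n) : V^T *m V = 1%:M ->
  char_poly (V *m D *m V^T) = char_poly D.
Proof.
move=> VV; rewrite /char_poly.
have VV' : map_mx polyC V *m map_mx polyC V^T = 1%:M.
  by rewrite -map_mxM (mulmx1C VV) map_mx1.
have -> : char_poly_mx (V *m D *m V^T) =
    map_mx polyC V *m char_poly_mx D *m map_mx polyC V^T.
  rewrite /char_poly_mx mulmxBr mulmxBl !map_mxM; congr (_ - _).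
  by rewrite mul_mx_scalar -scalemxAl VV' scalemx1.
by rewrite !det_mulmx mulrAC -det_mulmx VV' det1 mul1r.
Qed.

Lemma count_mem_flatten_nseq (T : eqType) (r : seq T) (f : T -> nat) x :
  uniq r ->
  count_mem x (flatten [seq nseq (f y) y | y <- r]) = ((x \in r) * f x)%N.
Proof.
elim: r => //= y r IHr /andP[yr ur]; rewrite count_cat IHr // count_nseq.
rewrite in_cons /=.
by rewrite eq_sym; have [->|] := eqVneq x y; rewrite ?(negbTE yr) ?addn0.
Qed.

(** The characteristic polynomial of A^T A is the product of the 'X - d i, so
    the multiplicity of x as a root is the number of i with d i = x. *)
Lemma perm_gram_eigenvalues m n (A : 'M[R]_(m, n)) V d :
    V^T *m V = 1%:M -> A^T *m A = V *m diag_mx d *m V^T ->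
  perm_eq (gram_eigenvalues A) [seq d 0 i | i <- enum 'I_n].
Proof.
move=> VV AA; rewrite /gram_eigenvalues AA char_poly_orthogonal_conj //.
rewrite char_poly_trig ?diag_mx_is_trig //.
have -> : \prod_i ('X - (diag_mx d i i)%:P) =
    \prod_(x <- [seq d 0 i | i <- enum 'I_n]) ('X - x%:P).
  by rewrite big_map big_enum; apply: eq_bigr => i _; rewrite mxE eqxx.
rewrite perm_sort; pose s := [seq d 0 i | i <- enum 'I_n].
rewrite -/s; apply/allP => x _ /=; apply/eqP.
have p0 : \prod_(x <- s) ('X - x%:P) != 0.
  by rewrite monic_neq0 ?monic_prod_XsubC.
rewrite count_mem_flatten_nseq ?uniq_roots // mu_prod_XsubC.
rewrite -roots_on_rootsR // root_prod_XsubC.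
by case: (boolP (x \in s)) => [|/count_memPn->]; rewrite ?mul1n.
Qed.

(** With A^T A = V diag(s^2) V^T, the columns of A V are pairwise orthogonal of
    norms s i; U is A V with its nonzero columns normalized and its zero
    columns kept.  So U has n columns and is only a partial isometry: this is
    enough, and it spares the completion to an orthonormal basis. *)
Lemma svd_exists m n (A : 'M[R]_(m, n)) :
  exists (U : 'M_(m, n)) (s : 'rV[R]_n) (V : 'M_n),
    [/\ forall i, 0 <= s 0 i, V^T *m V = 1%:M,
        U^T *m U = diag_mx (\row_i (s 0 i != 0)%:R)
      & A = U *m diag_mx s *m V^T].
Proof.
have [V [d [VV AA]]] : exists (V : 'M_n) (d : 'rV_n),
    [/\ V^T *m V = 1%:M & A^T *m A = V *m diag_mx d *m V^T].
  by apply: symmetric_spectral; rewrite trmx_mul trmxK.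
move BE: (A *m V) => B.
have BB : B^T *m B = diag_mx d.
  rewrite -BE trmx_mul -mulmxA (mulmxA A^T) AA !mulmxA VV mul1mx -mulmxA VV.
  by rewrite mulmx1.
have dE i : d 0 i = \sum_k B k i ^+ 2.
  have /matrixP/(_ i i) := BB; rewrite !mxE eqxx mulr1n => <-.
  by apply: eq_bigr => k _; rewrite mxE expr2.
have d0 i : 0 <= d 0 i by rewrite dE sumr_ge0 // => k _; apply: sqr_ge0.
have [s s0 s2] : exists2 s : 'rV_n,
    forall i, 0 <= s 0 i & forall i, s 0 i ^+ 2 = d 0 i.
  by exists (\row_i Num.sqrt (d 0 i)) => i; rewrite mxE ?sqrtr_ge0 ?sqr_sqrtr.
pose t : 'rV_n := \row_i (s 0 i)^-1.
exists (B *m diag_mx t), s, V; split => //.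
  rewrite trmx_mul tr_diag_mx -mulmxA (mulmxA B^T) BB !mulmx_diag.
  congr diag_mx; apply/rowP => i; rewrite !mxE -s2.
  by have [->|si] := eqVneq (s 0 i) 0; rewrite ?invr0 ?mul0r //=; field.
have -> : B *m diag_mx t *m diag_mx s = B.
  apply/matrixP => k i; rewrite -mulmxA mulmx_diag mul_mx_diag !mxE.
  have [si|si] := eqVneq (s 0 i) 0; last by rewrite mulVf ?mulr1.
  have := s2 i; rewrite si expr0n dE => /esym.
  move=> /psumr_eq0P/(_ k isT)/eqP; rewrite sqrf_eq0 => Bki.
  by rewrite !mulr0 (eqP (Bki _)) // => j _; apply: sqr_ge0.
by rewrite -BE -mulmxA (mulmx1C VV) mulmx1.
Qed.

Lemma mx_bound_svd_left m n (U : 'M[R]_(m, n)) (s : 'rV[R]_n) :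
  U^T *m U = diag_mx (\row_i (s 0 i != 0)%:R) -> mx_bound 1 U.
Proof.
move=> UU; apply: (mx_bound_gram_diag UU) => i.
by rewrite mxE expr1n; case: (_ != _).
Qed.

(** Both sides are read off the squared Frobenius norm of the partial isometry
    U: the columns contribute 1 or 0 according to s, and each of the m rows
    contributes at most 1. *)
Lemma count_neq0_svd m n (U : 'M[R]_(m, n)) (s : 'rV[R]_n) :
    U^T *m U = diag_mx (\row_i (s 0 i != 0)%:R) ->
  (\sum_i (s 0%R i != 0%R) <= m)%N.
Proof.
move=> UU; have bU := mx_bound_svd_left UU; rewrite -(ler_nat R) natr_sum.
have -> : \sum_i (s 0 i != 0)%:R = \sum_i \sum_j U j i ^+ 2 :> R.
  apply: eq_bigr => i _; have /matrixP/(_ i i) := UU; rewrite !mxE eqxx mulr1n => <-.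
  by apply: eq_bigr => j _; rewrite mxE expr2.
rewrite exchange_big /=.
apply: (@le_trans _ _ (\sum_(j < m) 1)); last by rewrite sumr_const card_ord.
by apply: ler_sum => j _; apply: mx_bound_row.
Qed.

(** The Schatten norm sums over the first min(m, n) sorted singular values,
    whereas s has n entries in arbitrary order.  At most m of the entries are
    nonzero, so the sorted list vanishes from index m on and the two sums
    agree. *)
Lemma schatten_norm_svd m n (A : 'M[R]_(m, n)) U (s : 'rV[R]_n) V :
    (forall i, 0 <= s 0 i) -> V^T *m V = 1%:M ->
    U^T *m U = diag_mx (\row_i (s 0 i != 0)%:R) ->
    A = U *m diag_mx s *m V^T ->
  forall p, schatten_norm p A = lp_norm p (s 0).
Proof.
move=> s0 VV UU AE.
have AA : A^T *m A = V *m diag_mx (\row_i s 0 i ^+ 2) *m V^T.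
  rewrite AE !trmx_mul trmxK tr_diag_mx -!mulmxA; congr (_ *m _).
  rewrite (mulmxA U^T) UU !mulmxA !mulmx_diag; congr (diag_mx _ *m _).
  apply/rowP => i; rewrite !mxE.
  by have [->|si] := eqVneq (s 0 i) 0; rewrite /= ?mul0r ?mulr1 -?expr2 ?expr0n.
have perm_e := perm_gram_eigenvalues VV AA.
have sorted_e : sorted >=%R (gram_eigenvalues A).
  by apply: sort_sorted => x y; apply: le_total.
set e := gram_eigenvalues A in perm_e sorted_e.
have size_e : size e = n by rewrite (perm_size perm_e) size_map size_enum_ord.
have e_ge0 x : x \in e -> 0 <= x.
  by rewrite (perm_mem perm_e) => /mapP[i _ ->]; rewrite mxE sqr_ge0.
have count_e : (count (fun x => x != 0%R) e <= m)%N.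
  rewrite (permP perm_e) count_map; apply: leq_trans (count_neq0_svd UU).
  rewrite -sum1_count big_mkcond /= big_enum /= leq_sum // => i _.
  by rewrite mxE sqrf_eq0; case: (_ != _).
have anti_e i j : (i <= j)%N -> (j < n)%N -> e`_j <= e`_i.
  move=> ij jn; apply: (sorted_leq_nth _ _ 0 sorted_e) => //.
  - by move=> y x z xy yz; apply: le_trans yz xy.
  - by move=> x; apply: lexx.
  - by rewrite inE size_e (leq_ltn_trans ij).
  - by rewrite inE size_e.
(* A nonzero entry at index j makes the first j + 1 entries nonzero. *)
have tail_e j : (m <= j < n)%N -> e`_j = 0.
  move=> /andP[mj jn]; apply/eqP; apply: contraTT count_e => ej.
  rewrite -ltnNge -(cat_take_drop j.+1 e) count_cat ltn_addr //.
  rewrite (_ : count _ _ = j.+1) // -[RHS](@size_takel _ _ e) ?size_e //.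
  apply/eqP; rewrite -all_count; apply/(all_nthP 0) => i.
  rewrite size_takel ?size_e // ltnS => ij; rewrite nth_take //.
  have ej0 : 0 < e`_j by rewrite lt_def ej e_ge0 ?mem_nth ?size_e.
  by rewrite gt_eqF // (lt_le_trans ej0) // anti_e.
have sqrtE i : Num.sqrt (s 0 i ^+ 2) = `|s 0 i| by rewrite sqrtr_sqr.
case=> [q q1|].
  rewrite /=; congr (_ `^ _).
  pose f x : R := Num.sqrt x ^+ q.
  rewrite -(big_mkord xpredT (fun j => f e`_j)).
  transitivity (\sum_(0 <= j < n) f e`_j).
    rewrite [RHS](big_cat_nat (n := minn m n)) ?geq_minr //=.
    rewrite [X in _ + X]big_nat_cond [X in _ + X]big1 ?addr0 // => j.
    rewrite andbT geq_min => /andP[mn jn]; rewrite /f tail_e.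
      by rewrite sqrtr0 expr0n gtn_eqF.
    by rewrite jn andbT; move: mn; rewrite [(n <= j)%N]leqNgt jn orbF.
  rewrite -[X in \sum_(_ <= _ < X) _]size_e -(big_nth 0 xpredT f).
  rewrite (perm_big _ perm_e) big_map big_enum /=.
  by apply: eq_bigr => i _; rewrite /f mxE sqrtE.
apply/eqP; rewrite eq_le; apply/andP; split.
  rewrite /= /two_norm /singular_value -/e; case: (posnP n) => [n0|n_gt0].
    rewrite nth_default ?sqrtr0 ?size_e ?n0 //.
    exact: (lp_norm_ge0 SchattenInf (s 0)).
  have : e`_0 \in e by rewrite mem_nth ?size_e.
  rewrite (perm_mem perm_e) => /mapP[i _ ->]; rewrite mxE sqrtE.
  exact: ler_lp_norm_inf.
apply/lp_norm_inf_le; first exact: sqrtr_ge0.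
move=> i; rewrite -sqrtE ler_sqrt.
  have : s 0 i ^+ 2 \in e.
    by rewrite (perm_mem perm_e); apply/mapP; exists i; rewrite ?mem_enum ?mxE.
  by move=> /(nthP 0)[k]; rewrite size_e => kn <-; apply: anti_e.
by rewrite e_ge0 // mem_nth // size_e (leq_ltn_trans (leq0n i)).
Qed.

End SingularValues.

(** * Variational formula for the Schatten norms *)

Section SchattenInequalities.
Variable R : realType.

(** By the singular value decomposition, a diagonal entry of F^T A G is
    sum_j P i j * s j * Q j i with contractions P and Q.  The weights
    |P i j * Q j i| are at most (P i j ^ 2 + Q j i ^ 2) / 2, and this matrix is
    doubly substochastic because rows and columns of a contraction have norm
    at most 1. *)
Lemma schatten_norm_diag_le p m n k (A : 'M[R]_(m, n))
    (F : 'M_(m, k)) (G : 'M_(n, k)) :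
    mx_bound 1 F -> mx_bound 1 G ->
  lp_norm p (fun i => (F^T *m A *m G) i i) <= schatten_norm p A.
Proof.
move=> bF bG; have [U [s [V [s0 VV UU AE]]]] := svd_exists A.
rewrite (schatten_norm_svd s0 VV UU AE).
pose P := F^T *m U; pose Q := V^T *m G.
have bU := mx_bound_svd_left UU.
have bP : mx_bound 1 P.
  by have := mx_boundM (mx_bound_tr bF) bU; rewrite mulr1.
have bQ : mx_bound 1 Q.
  by have := mx_boundM (mx_bound_tr (mx_bound_isometry VV)) bG; rewrite mulr1.
pose W i j := (P i j ^+ 2 + Q j i ^+ 2) / 2.
apply: (@lp_norm_substochastic _ _ _ _ W) => [i j|i|j|i].
- by rewrite divr_ge0 // addr_ge0 ?sqr_ge0.
- rewrite -mulr_suml ler_pdivrMr // big_split /= mul1r -[2]/(1 + 1).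
  by rewrite lerD ?mx_bound_row ?mx_bound_col.
- rewrite -mulr_suml ler_pdivrMr // big_split /= mul1r -[2]/(1 + 1).
  by rewrite lerD ?mx_bound_row ?mx_bound_col.
have -> : F^T *m A *m G = P *m (diag_mx s *m Q) by rewrite AE !mulmxA.
rewrite mxE (le_trans (ler_norm_sum _ _ _)) //; apply: ler_sum => j _.
rewrite mul_diag_mx mxE mulrCA normrM mulrC ler_wpM2r //.
rewrite /W ler_norml; apply/andP; split.
  rewrite -subr_ge0 (_ : _ - _ = (P i j + Q j i) ^+ 2 / 2); last by field.
  by rewrite divr_ge0 ?sqr_ge0.
rewrite -subr_ge0 (_ : _ - _ = (P i j - Q j i) ^+ 2 / 2); last by field.
by rewrite divr_ge0 ?sqr_ge0.
Qed.

Lemma schatten_norm_diag_eq m n (A : 'M[R]_(m, n)) :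
  exists (F : 'M_(m, n)) (G : 'M_n), [/\ mx_bound 1 F, mx_bound 1 G &
    forall p, schatten_norm p A = lp_norm p (fun i => (F^T *m A *m G) i i)].
Proof.
have [U [s [V [s0 VV UU AE]]]] := svd_exists A; exists U, V; split.
- exact: mx_bound_svd_left UU.
- exact: mx_bound_isometry.
move=> p; rewrite (schatten_norm_svd s0 VV UU AE); apply: lp_norm_eq => i.
have -> : U^T *m A *m V = diag_mx s.
  rewrite AE -!mulmxA VV mulmx1 mulmxA UU mulmx_diag; congr diag_mx.
  apply/rowP => j; rewrite !mxE.
  by have [->|_] := eqVneq (s 0 j) 0; rewrite ?mulr0 //= mul1r.
by rewrite mxE eqxx mulr1n.
Qed.

Lemma schatten_norm_triangle p m n (A B : 'M[R]_(m, n)) :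
  schatten_norm p (A + B) <= schatten_norm p A + schatten_norm p B.
Proof.
have [F [G [bF bG ->]]] := schatten_norm_diag_eq (A + B).
apply: le_trans (lerD (schatten_norm_diag_le p A bF bG)
                      (schatten_norm_diag_le p B bF bG)).
apply: le_trans (lp_norm_triangle _ _ _); rewrite le_eqVlt; apply/orP; left.
by apply/eqP/lp_norm_eq => i; rewrite mulmxDr mulmxDl mxE.
Qed.

(** F^T (B A) G = c (E^T A G) with E = c^-1 B^T F, again a contraction.  For
    c = 0 this still makes sense, since then B = 0 and c^-1 = 0. *)
Lemma schatten_norm_mulmx_le p m k n c (B : 'M[R]_(k, m)) (A : 'M_(m, n)) :
  0 <= c -> mx_bound c B -> schatten_norm p (B *m A) <= c * schatten_norm p A.
Proof.
move=> c0 bB; have [F [G [bF bG ->]]] := schatten_norm_diag_eq (B *m A).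
pose E := c^-1 *: (B^T *m F).
have BE : B^T *m F = c *: E.
  rewrite scalerA; have [c00|cn0] := eqVneq c 0; last by rewrite mulfV ?scale1r.
  by move: bB; rewrite c00 => /mx_bound0->; rewrite trmx0 mul0mx scaler0.
have bE : mx_bound 1 E.
  have := mx_boundZ c^-1 (mx_boundM (mx_bound_tr bB) bF); rewrite mulr1.
  apply: mx_bound_le; first by rewrite mulr_ge0 ?invr_ge0.
  by have [->|cn0] := eqVneq c 0; rewrite ?mulr0 ?mulVf.
have := ler_wpM2l c0 (schatten_norm_diag_le p A bE bG).
apply: le_trans; rewrite -(ger0_norm c0) -lp_normZ.
rewrite le_eqVlt; apply/orP; left; apply/eqP/lp_norm_eq => i.
rewrite !mulmxA -[F^T *m B]trmxK trmx_mul trmxK BE linearZ /= -!scalemxAl.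
by rewrite mxE.
Qed.

Lemma two_norm_ge0 m n (A : 'M[R]_(m, n)) : 0 <= two_norm A.
Proof. exact: sqrtr_ge0. Qed.

Lemma mx_bound_two_norm m n (A : 'M[R]_(m, n)) : mx_bound (two_norm A) A.
Proof.
have [U [s [V [s0 VV UU AE]]]] := svd_exists A.
have two_normE := schatten_norm_svd s0 VV UU AE SchattenInf.
have bU := mx_bound_svd_left UU.
have bs : mx_bound (two_norm A) (diag_mx s).
  apply: (@mx_bound_gram_diag _ _ _ _ _ (\row_i s 0 i ^+ 2)) => [|i].
    by rewrite tr_diag_mx mulmx_diag.
  rewrite mxE lerXn2r ?nnegrE ?two_norm_ge0 //.
  rewrite -[s 0 i]ger0_norm // -[two_norm A]/(schatten_norm SchattenInf A).
  rewrite two_normE.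
  exact: ler_lp_norm_inf.
have := mx_boundM (mx_boundM bU bs) (mx_bound_tr (mx_bound_isometry VV)).
by rewrite mul1r mulr1 -AE.
Qed.

Lemma two_norm_le m n c (A : 'M[R]_(m, n)) :
  0 <= c -> mx_bound c A -> two_norm A <= c.
Proof.
move=> c0 bA; have [F [G [bF bG AE]]] := schatten_norm_diag_eq A.
rewrite -[two_norm A]/(schatten_norm SchattenInf A) AE.
apply/lp_norm_inf_le => // i; apply: mx_bound_entry => //.
have := mx_boundM (mx_boundM (mx_bound_tr bF) bA) bG.
by rewrite mul1r mulr1.
Qed.

Lemma two_normN m n (A : 'M[R]_(m, n)) : two_norm (- A) = two_norm A.
Proof.
rewrite /two_norm /singular_value /gram_eigenvalues mulmxN -mulNmx.
by rewrite -linearN /= opprK.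
Qed.

Lemma two_norm_eq0 m n (A : 'M[R]_(m, n)) : two_norm A = 0 -> A = 0.
Proof. by move=> A0; apply: mx_bound0; rewrite -A0; apply: mx_bound_two_norm. Qed.

End SchattenInequalities.

(** * Orthogonal projectors of equal rank *)

Section Projectors.
Variable R : realType.

Definition orthoproj m (P : 'M[R]_m) : Prop := P^T = P /\ P *m P = P.

Lemma orthoprojC m (P : 'M[R]_m) : orthoproj P -> orthoproj (1%:M - P).
Proof.
case=> Psym PP; split; first by rewrite linearB /= trmx1 Psym.
by rewrite mulmxBl mul1mx mulmxBr mulmx1 PP subrr subr0.
Qed.

Lemma sqnorm_orthoprojD m k (P : 'M[R]_m) (X Y : 'M_(m, k)) : orthoproj P ->
  sqnorm (P *m X + (1%:M - P) *m Y) = sqnorm (P *m X) + sqnorm ((1%:M - P) *m Y).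
Proof.
case=> Psym PP; rewrite sqnormD mxdot_mull Psym mulmxA mulmxBr mulmx1 PP.
by rewrite subrr mul0mx /mxdot mulmx0 mxtrace0 mulr0 addr0.
Qed.

Lemma sqnorm_orthoproj m k (P : 'M[R]_m) (X : 'M_(m, k)) : orthoproj P ->
  sqnorm X = sqnorm (P *m X) + sqnorm ((1%:M - P) *m X).
Proof.
by move=> pP; rewrite -sqnorm_orthoprojD // -mulmxDl addrC subrK mul1mx.
Qed.

Lemma mx_bound_orthoproj m (P : 'M[R]_m) : orthoproj P -> mx_bound 1 P.
Proof.
move=> pP k X; rewrite expr1n mul1r (sqnorm_orthoproj X pP) lerDl.
exact: sqnorm_ge0.
Qed.

(** The content is the case s < 1.  For Y in the range of Q the hypothesis
    gives (1 - s^2) |Y|^2 <= |P Y|^2, so P is injective on the range of Q and,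
    the ranks being equal, maps it onto the range of P.  Every W in the range
    of P is then P Y with Q Y = Y, and (Q W) . Y = W . Y = |W|^2; comparing Q W
    with (1 - s^2) Y yields |Q W|^2 >= (1 - s^2) |W|^2, that is,
    |(I - Q) W| <= s |W|. *)
Lemma mx_bound_orthoproj_swap m s (P Q : 'M[R]_m) :
    orthoproj P -> orthoproj Q -> \rank P = \rank Q -> 0 <= s ->
  mx_bound s ((1%:M - P) *m Q) -> mx_bound s (P *m (1%:M - Q)).
Proof.
move=> pP pQ rPQ s0 bs; have [s1|s1] := leP 1 s.
  apply: mx_bound_le s1 _ => //.
  have := mx_boundM (mx_bound_orthoproj pP) (mx_bound_orthoproj (orthoprojC pQ)).
  by rewrite mulr1.
have [[Psym PP] [Qsym QQ]] := (pP, pQ).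
have t0 : 0 < 1 - s ^+ 2 by rewrite subr_gt0 expr_lt1.
have low k (Y : 'M_(m, k)) : Q *m Y = Y ->
    (1 - s ^+ 2) * sqnorm Y <= sqnorm (P *m Y).
  move=> QY; have := bs _ Y; rewrite -mulmxA QY => le_s.
  by rewrite mulrBl mul1r lerBlDr (sqnorm_orthoproj Y pP) lerD2l
    -(sqnorm_orthoproj Y pP).
have [D PE] : exists D, P = P *m (Q *m D).
  have rQP : \rank (Q *m P) = \rank Q.
    apply/(mxrank_injP m); rewrite -submx0; apply/rV_subP => u.
    rewrite sub_capmx => /andP[/submxP[v ->]] /sub_kermxP vQP0.
    have QY : Q *m (v *m Q)^T = (v *m Q)^T.
      by rewrite trmx_mul Qsym mulmxA QQ.
    have := low _ _ QY; rewrite -[P]trmxK -trmx_mul Psym vQP0 trmx0 sqnorm0.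
    rewrite pmulr_rle0 // => le0.
    rewrite submx0 -[v *m Q]trmxK (_ : (v *m Q)^T = 0) ?trmx0 //.
    by apply/eqP; rewrite -sqnorm_eq0 eq_le le0 sqnorm_ge0.
  have /submxP[D PE] : (P <= Q *m P)%MS.
    by rewrite -(geq_leqif (mxrank_leqif_sup (submxMl Q P))) rQP rPQ.
  by exists D^T; rewrite -{1}Psym {1}PE !trmx_mul Psym Qsym mulmxA.
rewrite -[P *m _]trmxK; apply: mx_bound_tr => k X.
rewrite trmx_mul Psym (proj1 (orthoprojC pQ)) -mulmxA.
pose Y := Q *m (D *m X); pose W := P *m X.
have QY : Q *m Y = Y by rewrite /Y mulmxA QQ.
have PY : P *m Y = W by rewrite /Y /W {2}PE !mulmxA.
have WY : mxdot W Y = sqnorm W.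
  rewrite /W -{1}PP -mulmxA -/W (mxdot_mull P) Psym.
  by rewrite PY.
have bY := low _ _ QY; rewrite PY in bY.
have := sqnorm_ge0 (Q *m W + (- (1 - s ^+ 2)) *: Y).
rewrite sqnormDZ mxdot_mull Qsym QY WY => ge0.
have WE := sqnorm_orthoproj W pQ.
have bW : s ^+ 2 * sqnorm W <= s ^+ 2 * sqnorm X.
  by rewrite ler_wpM2l ?sqr_ge0 // (sqnorm_orthoproj X pP) lerDl sqnorm_ge0.
apply: le_trans bW; rewrite -/W; set a := sqnorm (Q *m W) in ge0 WE *.
set b := sqnorm ((1%:M - Q) *m W) in WE *.
have := ler_wpM2l (ltW t0) bY.
rewrite sqrrN expr2 -!mulrA in ge0.
move: ge0 WE; set ty := _ * (_ * sqnorm Y); lra.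
Qed.

(** P - Q = P (I - Q) - (I - P) Q, where the two terms have orthogonal ranges
    and act on the orthogonal components (I - Q) X and Q X of X. *)
Lemma mx_bound_orthoproj_sub m s (P Q : 'M[R]_m) :
    orthoproj P -> orthoproj Q -> \rank P = \rank Q -> 0 <= s ->
  mx_bound s ((1%:M - P) *m Q) -> mx_bound s (P - Q).
Proof.
move=> pP pQ rPQ s0 bs k X.
have bs' := mx_bound_orthoproj_swap pP pQ rPQ s0 bs.
have -> : (P - Q) *m X = P *m ((1%:M - Q) *m X) + (1%:M - P) *m (- (Q *m X)).
  rewrite mulmxN !mulmxBl !mul1mx mulmxBr opprB addrA.
  by rewrite subrK.
rewrite sqnorm_orthoprojD // mulmxN sqnormN (sqnorm_orthoproj X pQ) mulrDr addrC.
apply: lerD.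
  by have := bs _ (Q *m X); rewrite -mulmxA (mulmxA Q) (proj2 pQ).
have := bs' _ ((1%:M - Q) *m X).
by rewrite -mulmxA (mulmxA (1%:M - Q)) (proj2 (orthoprojC pQ)).
Qed.

End Projectors.

(** * Perturbation of the projector *)

Lemma rank_pseudoinverse_range (R : realType) m n (M : 'M[R]_(m, n)) :
  \rank (M *m pseudoinverse M) = \rank M.
Proof.
have [MXM _ _ _] := pseudoinverseP M; apply/eqP; rewrite eqn_leq mxrankM_maxl.
by rewrite -{1}MXM mxrankM_maxl.
Qed.

Lemma orthoproj_pseudoinverse (R : realType) m n (M : 'M[R]_(m, n)) :
  orthoproj (M *m pseudoinverse M).
Proof.
by have [MXM _ sym _] := pseudoinverseP M; split; rewrite // mulmxA MXM.
Qed.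

Theorem theorem1 (R : realType) (m n l : nat)
    (A : 'M[R]_(m, n)) (Z Zhat : 'M[R]_(m, l)) (p : schatten_index)
    (Z_orthonormal : Z^T *m Z = 1%:M) :
  let eps := two_norm (pseudoinverse Zhat) * two_norm (Z - Zhat) in
  [/\ Zhat != 0 ->
        eps = two_norm Zhat * two_norm (pseudoinverse Zhat)
              * (two_norm (Zhat - Z) / two_norm Zhat),
      \rank Zhat = \rank Z ->
        schatten_norm p ((1%:M - Z *m Z^T) *m A) - eps * schatten_norm p A
          <= schatten_norm p ((1%:M - Zhat *m pseudoinverse Zhat) *m A)
        /\ schatten_norm p ((1%:M - Zhat *m pseudoinverse Zhat) *m A)
          <= schatten_norm p ((1%:M - Z *m Z^T) *m A) + eps * schatten_norm p A
    & two_norm (Z - Zhat) <= 2^-1 ->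
        \rank Zhat = \rank Z /\ eps <= 2 * two_norm (Z - Zhat)].
Proof.
move=> eps; pose X := pseudoinverse Zhat.
have [ZXZ XZX _ XZsym] := pseudoinverseP Zhat; rewrite -/X in ZXZ XZX XZsym.
pose P := Z *m Z^T; pose Q := Zhat *m X.
have pQ : orthoproj Q := orthoproj_pseudoinverse Zhat.
have pP : orthoproj P.
  split; first by rewrite trmx_mul trmxK.
  by rewrite /P mulmxA -(mulmxA Z) Z_orthonormal mulmx1.
have rankZ : \rank Z = l.
  apply/eqP; rewrite eqn_leq rank_leq_col -{1}(mxrank1 R l) -Z_orthonormal.
  exact: mxrankM_maxr.
have rankP : \rank P = \rank Z.
  apply/eqP; rewrite eqn_leq mxrankM_maxl -{1}[Z]mulmx1 -Z_orthonormal mulmxA.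
  exact: mxrankM_maxl.
have eps_ge0 : 0 <= eps by rewrite mulr_ge0 ?two_norm_ge0.
split.
- move=> Zhat0; have nz : two_norm Zhat != 0.
    by apply: contra_neq Zhat0 => /two_norm_eq0.
  by rewrite /eps -[Zhat - Z]opprB two_normN; field.
- move=> rk.
  have rPQ : \rank P = \rank Q by rewrite rankP rank_pseudoinverse_range.
  have bPQ : mx_bound eps (P - Q).
    apply: mx_bound_orthoproj_sub => //.
    have -> : (1%:M - P) *m Q = - ((1%:M - P) *m (Z - Zhat) *m X).
      rewrite (mulmxBr _ Z) (_ : (1%:M - P) *m Z = 0).
        by rewrite sub0r mulNmx opprK mulmxA.
      by rewrite mulmxBl mul1mx /P -mulmxA Z_orthonormal mulmx1 subrr.
    apply: mx_boundN; rewrite /eps mulrC -[two_norm (Z - _)]mul1r.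
    apply: mx_boundM (mx_bound_two_norm _).
    apply: mx_boundM (mx_bound_two_norm _).
    by apply: mx_bound_orthoproj; apply: orthoprojC.
  split.
    rewrite lerBlDr.
    have -> : (1%:M - P) *m A = (1%:M - Q) *m A + - (P - Q) *m A.
      by rewrite -mulmxDl opprB addrA subrK.
    apply: le_trans (schatten_norm_triangle _ _ _) _; rewrite lerD2l.
    by apply: schatten_norm_mulmx_le => //; apply: mx_boundN.
  have -> : (1%:M - Q) *m A = (1%:M - P) *m A + (P - Q) *m A.
    by rewrite -mulmxDl addrA subrK.
  apply: le_trans (schatten_norm_triangle _ _ _) _; rewrite lerD2l.
  exact: schatten_norm_mulmx_le.
move=> dist.
have low k (Y : 'M_(l, k)) : sqnorm Y <= 4 * sqnorm (Zhat *m Y).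
  have ZY : sqnorm (Z *m Y) = sqnorm Y.
    by rewrite /sqnorm mxdot_mull mulmxA Z_orthonormal mul1mx.
  have bd : sqnorm ((Z - Zhat) *m Y) <= 2^-1 ^+ 2 * sqnorm Y.
    by apply: (mx_bound_le (two_norm_ge0 _) dist (@mx_bound_two_norm _ _ _ _)).
  (* |u + v|^2 <= 2 |u|^2 + 2 |v|^2, from |u - v|^2 >= 0 *)
  have := sqnorm_ge0 (Zhat *m Y + (-1) *: ((Z - Zhat) *m Y)).
  have := sqnormD (Zhat *m Y) ((Z - Zhat) *m Y).
  rewrite -mulmxDl addrC subrK ZY sqnormDZ; lra.
have inj k (Y : 'M_(l, k)) : Zhat *m Y = 0 -> Y = 0.
  move=> ZY0; have := low _ Y; rewrite ZY0 sqnorm0 mulr0 => le0.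
  by apply/eqP; rewrite -sqnorm_eq0 eq_le le0 sqnorm_ge0.
have XZ1 : X *m Zhat = 1%:M.
  apply/eqP; rewrite -subr_eq0; apply/eqP/inj.
  by rewrite mulmxBr mulmx1 mulmxA ZXZ subrr.
split.
  rewrite rankZ; apply/eqP; rewrite eqn_leq rank_leq_col -{1}(mxrank1 R l) -XZ1.
  exact: mxrankM_maxr.
rewrite /eps ler_wpM2r ?two_norm_ge0 // two_norm_le // => k Y.
have -> : (2 : R) ^+ 2 = 4 by rewrite -natrX.
rewrite (le_trans (low _ _)) // ler_pM2l // mulmxA.
by have := mx_bound_orthoproj pQ Y; rewrite expr1n mul1r.
Qed.
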